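(* Let $p$ be a prime, $q=p^n$, and let $d$ be a natural number with $(d,p)=1$. Let $\psi$ be a nontrivial additive character of $\mathbb{F}_p$ and $r\ge 1$ a natural number. Then $$M_d^r=-e_{p,r}\,q^{r/p-r/2}+O\left(r\,q^{r/2-(1-1/p)d}+q^{-r/2}\right),$$ where the implied constant is absolute (it does not depend on $p,q,r,d$).
   Context: $\mathcal{F}_d$ denotes the set of polynomials $f=\sum_{i=0}^d a_ix^i\in\mathbb{F}_q[x]$ with $a_d\neq 0$ and $a_i=0$ for every $i\ge 0$ divisible by $p$ (in particular $a_0=0$). For $f\in\mathcal{F}_d$ and a nontrivial additive character $\psi$ of $\mathbb{F}_p$, $$L_{f,\psi}(z)=\exp\left(\sum_{r=1}^\infty\sum_{\alpha\in\mathbb{F}_{q^r}}\psi\left(\mathrm{Tr}_{\mathbb{F}_{q^r}/\mathbb{F}_p}f(\alpha)\right)\frac{z^r}{r}\right);$$ it is a polynomial of degree $d-1$ which factors as $L_{f,\psi}(z)=\prod_{i=1}^{d-1}(1-q^{1/2}\rho_iz)$ with $|\rho_i|=1$ (the normalised zeroes). $T^r_{f,\psi}=\sum_{i=1}^{d-1}\rho_i^r$, and $M_d^r$ is the average of $T^r_{f,\psi}$ as $f$ ranges uniformly over $\mathcal{F}_d$ (it does not depend on $\psi$). $e_{p,r}=1$ if $p\mid r$ and $e_{p,r}=0$ if $(r,p)=1$. *)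

(* Defs.v *)
(* Complex numbers are modelled by algC (algebraic complex
   numbers): all quantities in the statement (character values, q^{1/2},
   q^{1/p}, the zeroes of L) are algebraic. *)
From HB Require Import structures.
From mathcomp Require Import all_boot all_order all_algebra all_field.
Set Implicit Arguments.
Unset Strict Implicit.
Unset Printing Implicit Defensive.
Import Order.TTheory GRing.Theory Num.Theory.
Local Open Scope ring_scope.

Section Defs.
(* p prime, q = p^n, F a finite field with q elements, K s a finite field with
   q^s elements (the field F_{q^s}) together with an embedding of F into it. *)
Variables (p n : nat) (F : finFieldType) (K : nat -> finFieldType)
          (iota : forall s, {rmorphism F -> K s}) (psi : 'F_p -> algC).

Definition qC : algC := (p ^ n)%:R.

(* Tr_{F_{q^s}/F_p}(y) = sum_{i < ns} y^(p^i); lands in the prime field. *)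
Definition trFp (s : nat) (y : K s) : K s := \sum_(i < n * s) y ^+ (p ^ i).

Definition toFp (s : nat) (y : K s) : 'F_p :=
  odflt 0 [pick k : 'F_p | ((val k)%:R : K s) == y].

Definition expsum (f : {poly F}) (s : nat) : algC :=
  \sum_(a : K s) psi (toFp (trFp ((map_poly (iota s) f).[a]))).

(* coefficients c_0..c_m of L(z) = exp(sum_{s>=1} S_s z^s / s), computed by
   c_0 = 1 and m c_m = sum_{k=1}^m S_k c_{m-k}. *)
Fixpoint Lcoefs (f : {poly F}) (m : nat) : seq algC :=
  match m with
  | 0 => [:: 1]
  | m'.+1 => let cs := Lcoefs f m' in
      rcons cs ((m'.+1)%:R^-1 *
                \sum_(k < m'.+1) expsum f k.+1 * nth 0 cs (m' - k))
  end.

Definition Lcoef (f : {poly F}) (m : nat) : algC := nth 0 (Lcoefs f m) m.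

(* L_{f,psi}(z), which is a polynomial of degree d-1 (d = deg f), i.e. the
   power series truncated at degree d-1. *)
Definition Lpoly (d : nat) (f : {poly F}) : {poly algC} :=
  \poly_(i < d) Lcoef f i.

(* reversed polynomial z^{d-1} L(1/z) = prod_i (z - q^{1/2} rho_i) *)
Definition Lrev (d : nat) (f : {poly F}) : {poly algC} :=
  \poly_(i < d) Lcoef f (d.-1 - i).

Definition Lrecroots (d : nat) (f : {poly F}) : seq algC :=
  sval (closed_field_poly_normal (Lrev d f)).

Definition Tr_zeros (d r : nat) (f : {poly F}) : algC :=
  \sum_(b <- Lrecroots d f) (b / sqrtC qC) ^+ r.

Definition Fam (d : nat) : {set {ffun 'I_d.+1 -> F}} :=
  [set a : {ffun 'I_d.+1 -> F} | (a ord_max != 0) &&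
     [forall i : 'I_d.+1, (p %| i)%N ==> (a i == 0)]].

Definition polyOf (d : nat) (a : {ffun 'I_d.+1 -> F}) : {poly F} :=
  \poly_(i < d.+1) a (inord i).

Definition Mavg (d r : nat) : algC :=
  (\sum_(a in Fam d) Tr_zeros d r (polyOf a)) / (#|Fam d|)%:R.

End Defs.

Definition epr (p r : nat) : algC := (p %| r)%N%:R.

(* Main.v *)
(* By Newton's identities Tr_zeros is -q^(-r/2) times the r-th exponential sum,
   once L is known to be a polynomial of degree < d.  To see this, attach to a
   monic g in F[x] the value chi(g) = Theta(sum_i f_i ps_i(g)), where ps_i is the
   i-th power sum of the roots and Theta = psi o Tr.  Counting, for a fixed g, the
   a in the fields K k whose characteristic polynomial over F divides g gives
   exactly deg g, so C_m := sum_(g monic, deg g = m) chi(g) obeys the recursion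
   defining the coefficients of L.  For m >= d, moving the coefficient of x^(m-d)
   of g changes only ps_d (by a multiple of d), so C_m = 0.

   Averaging over f, orthogonality of characters leaves only the a in K r with
   Tr(a^i) = 0 for all i < d prime to p.  Elements of the subfield with q^(r/p)
   elements always qualify and give the main term.  If r < d only a = 0 remains;
   if r >= d, Newton's identities force the coefficients of x^(r-i) in the
   characteristic polynomial of a to vanish for i < d prime to p, which bounds
   the number of such a. *)
Require Import Defs.
From HB Require Import structures.
From mathcomp Require Import all_boot all_order all_algebra all_field.
From mathcomp Require Import qpoly qfpoly zify ring.
Import Order.TTheory GRing.Theory Num.Theory.
Local Open Scope ring_scope.
Set Implicit Arguments.
Unset Strict Implicit.
Unset Printing Implicit Defensive.

(** * Newton power sums *)

Lemma coef_mulXn (R : nzRingType) (N : nat) (H : {poly R}) (i : nat) :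
  (i < N)%N -> ('X^N * H)`_i = 0.
Proof. by move=> iN; rewrite coefXnM iN. Qed.

Lemma lowcoef0P (R : nzRingType) (N : nat) (A : {poly R}) :
  (forall i, (i < N)%N -> A`_i = 0) -> exists H, A = 'X^N * H.
Proof.
move=> A0; exists (drop_poly N A).
rewrite -commr_polyXn -[LHS](poly_take_drop N).
suff -> : take_poly N A = 0 by rewrite add0r.
by apply/polyP=> i; rewrite coef_take_poly coef0; case: ifP => // /A0.
Qed.

Section NewtonPowerSums.
Variable R : comNzRingType.
Implicit Types P Q : {poly R}.

(* The coefficient of X^i in -X Q'/Q; it is the i-th power sum of the b's when
   Q = prod_b (1 - b X). *)
Definition ps Q (i : nat) : R := (- Q^`() * \sum_(j < i) (1 - Q) ^+ j)`_i.-1.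

(* P = -Q'/Q modulo X^N *)
Definition neglogder Q P (N : nat) := forall i, (i < N)%N -> (Q^`() + P * Q)`_i = 0.

(** Since [1 - Q] has no constant term, the geometric series in [1 - Q] cut off after [N] terms
    inverts [Q] modulo [X^N]. This is why a finite sum suffices in [ps]. *)
Lemma one_sub_exp Q N : Q`_0 = 1 -> exists H, (1 - Q) ^+ N = 'X^N * H.
Proof.
move=> Q0; have [H ->] : exists H, 1 - Q = 'X^1 * H.
  by apply: lowcoef0P => -[] // _; rewrite coefB coef1 Q0 subrr.
by exists (H ^+ N); rewrite expr1 exprMn.
Qed.

(** Multiplying the congruence for [P] by the truncated inverse of [Q] isolates [P], so power sums
    can be read off from any convenient [P]. *)
Lemma ps_neglogder Q P N i : Q`_0 = 1 -> neglogder Q P N ->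
  (i < N)%N -> ps Q i.+1 = P`_i.
Proof.
move=> Q0 /lowcoef0P[H QP] iN; rewrite /ps /=.
have -> : - Q^`() = P * Q - 'X^N * H by rewrite -QP; ring.
have [H1 eH1] := one_sub_exp i.+1 Q0.
have /(congr1 (fun A => - A)) := subrX1 (1 - Q) i.+1; rewrite eH1.
set G := \sum_(_ < _) _ => eG.
have {}eG : Q * G = 1 - 'X^(i.+1) * H1 by rewrite -[1 - _]opprB eG; ring.
have -> : (P * Q - 'X^N * H) * G = P - 'X^(i.+1) * (H1 * P) - 'X^N * (H * G).
  by rewrite mulrBl -mulrA eG; ring.
by rewrite !coefB !coef_mulXn // !subr0.
Qed.

Lemma neglogder_exists Q N : Q`_0 = 1 -> exists P, neglogder Q P N.
Proof.
move=> Q0; exists (- Q^`() * \sum_(j < N) (1 - Q) ^+ j) => i iN.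
have [H1 eH1] := one_sub_exp N Q0.
have /(congr1 (fun A => - A)) := subrX1 (1 - Q) N; rewrite eH1.
set G := \sum_(_ < _) _ => eG.
have {}eG : Q * G = 1 - 'X^N * H1 by rewrite -[1 - _]opprB eG; ring.
have -> : Q^`() + - Q^`() * G * Q = 'X^N * (H1 * Q^`()).
  by rewrite -mulrA [G * Q]mulrC eG; ring.
by rewrite coef_mulXn.
Qed.

Lemma neglogderM Q1 Q2 P1 P2 N : neglogder Q1 P1 N -> neglogder Q2 P2 N ->
  neglogder (Q1 * Q2) (P1 + P2) N.
Proof.
move=> /lowcoef0P[H1 e1] /lowcoef0P[H2 e2] i iN; rewrite derivM.
have -> : Q1^`() * Q2 + Q1 * Q2^`() + (P1 + P2) * (Q1 * Q2) =
  (Q1^`() + P1 * Q1) * Q2 + (Q2^`() + P2 * Q2) * Q1 by ring.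
by rewrite e1 e2 -!mulrA -mulrDr coef_mulXn.
Qed.

Lemma psM Q1 Q2 i : Q1`_0 = 1 -> Q2`_0 = 1 ->
  ps (Q1 * Q2) i.+1 = ps Q1 i.+1 + ps Q2 i.+1.
Proof.
move=> h1 h2; have [P1 e1] := neglogder_exists i.+1 h1.
have [P2 e2] := neglogder_exists i.+1 h2.
rewrite (ps_neglogder h1 e1) // (ps_neglogder h2 e2) //.
rewrite (ps_neglogder _ (neglogderM e1 e2)) ?coefD //.
by rewrite coef0M h1 h2 mulr1.
Qed.

Lemma ps1 i : ps 1 i = 0.
Proof. by rewrite /ps derivC oppr0 mul0r coef0. Qed.

Lemma ps_linear (b : R) i : ps (1 - b *: 'X) i.+1 = b ^+ i.+1.
Proof.
rewrite /ps /= derivB derivC derivZ derivX sub0r opprK opprB addrC subrK.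
rewrite -scalerAl mul1r coefZ coef_sum (bigD1 ord_max) //= big1.
  by rewrite exprZn coefZ coefXn eqxx mulr1 addr0 exprS.
move=> j jm; rewrite exprZn coefZ coefXn eq_sym.
by rewrite (negbTE (jm : nat_of_ord j != i)) mulr0.
Qed.

Lemma prod_linear0 (s : seq R) : (\prod_(b <- s) (1 - b *: 'X))`_0 = 1.
Proof.
elim: s => [|b s IH]; first by rewrite big_nil coef1.
by rewrite big_cons coef0M IH mulr1 coefB coef1 coefZ coefX mulr0 subr0.
Qed.

Lemma ps_prod (s : seq R) i :
  ps (\prod_(b <- s) (1 - b *: 'X)) i.+1 = \sum_(b <- s) b ^+ i.+1.
Proof.
elim: s => [|b s IH]; first by rewrite !big_nil ps1.
rewrite !big_cons psM ?prod_linear0 ?IH ?ps_linear //.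
by rewrite coefB coef1 coefZ coefX mulr0 subr0.
Qed.

(** As [Q] is 1 modulo [X], the perturbation changes [-Q'/Q] modulo [X^d] only by [-d t X^(d-1)];
    all other corrections are multiples of [X^d]. *)
Lemma ps_shift Q (t : R) d i : Q`_0 = 1 -> (i < d)%N ->
  ps (Q + t *: 'X^d) i.+1 = ps Q i.+1 - (i.+1 == d)%:R * (t *+ d).
Proof.
move=> Q0 id; have [P e] := neglogder_exists d Q0.
have Qd0 : (Q + t *: 'X^d)`_0 = 1.
  by rewrite coefD coefZ coefXn Q0; case: (d) id => //=; rewrite mulr0 addr0.
rewrite (ps_neglogder Q0 e) //.
rewrite (@ps_neglogder _ (P - (t *+ d) *: 'X^(d.-1)) d) //; last first.
  have /lowcoef0P[H eH] := e; have [H1] := one_sub_exp 1 Q0; rewrite !expr1 => eH1.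
  move=> j jd; rewrite derivD derivZ derivXn.
  have d1 : 'X^d = 'X^(d.-1) * 'X :> {poly R} by rewrite -exprSr prednK //; case: (d) id.
  have -> : Q^`() + t *: ('X^(d.-1) *+ d) +
      (P - (t *+ d) *: 'X^(d.-1)) * (Q + t *: 'X^d) =
      (Q^`() + P * Q) + t *: (P * 'X^d) + (t *+ d) *: ('X^(d.-1) * (1 - Q))
       - (t *+ d * t) *: ('X^(d.-1) * 'X^d).
    rewrite -scalerMnr scalerMnl; set c := t *+ d.
    by rewrite -!mul_polyC polyCM; ring.
  rewrite eH1 mulrA -d1 eH [P * _]mulrC [_ * 'X^d]mulrC.
  by rewrite coefB !coefD !coefZ !coef_mulXn // !mulr0 !addr0 subr0.
rewrite coefB coefZ coefXn; congr (_ - _); rewrite mulrC.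
by congr (_ %:R * _); lia.
Qed.

(** Newton's identities express [i Q_i] through the power sums up to index [i]. The factor [i]
    stays, as it may vanish in [R]. *)
Lemma ps0_coef Q N : Q`_0 = 1 -> (forall i, (0 < i < N)%N -> ps Q i = 0) ->
  forall i, (0 < i < N)%N -> Q`_i *+ i = 0.
Proof.
move=> Q0 h [//|i] /andP[_ iN]; have [P e] := neglogder_exists i.+1 Q0.
have := e i (ltnSn i); rewrite coefD coef_deriv coefM big1 ?addr0 // => j _.
have jN : (j < i.+1)%N by [].
rewrite -(ps_neglogder Q0 e) // h ?mul0r //.
by rewrite (leq_ltn_trans _ iN).
Qed.

End NewtonPowerSums.

Lemma ps_map (R S : comNzRingType) (f : {rmorphism R -> S}) (Q : {poly R}) i :
  ps (map_poly f Q) i = f (ps Q i).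
Proof.
rewrite /ps deriv_map -[RHS]coef_map rmorphM rmorphN rmorph_sum /=.
congr (nth _ (polyseq (_ * _)) _); apply: eq_bigr => j _.
by rewrite rmorphXn rmorphB rmorph1.
Qed.

(** * Reversal of polynomials *)

Section ReversedPolynomial.
Variable R : comNzRingType.
Implicit Types g h : {poly R}.

(** This is [X^m g(1/X)] for [g] of degree at most [m]. With the formal degree as a parameter, the
    reversal is additive for fixed [m] and multiplicative when the formal degrees add up. *)
Definition revp (m : nat) g : {poly R} := \poly_(i < m.+1) g`_(m - i).

Lemma coef_revp m g i : (revp m g)`_i = if (i <= m)%N then g`_(m - i) else 0.
Proof. by rewrite coef_poly ltnS. Qed.

Lemma revpD m g h : revp m (g + h) = revp m g + revp m h.
Proof.
apply/polyP=> i; rewrite coefD !coef_revp coefD.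
by case: ifP; rewrite // addr0.
Qed.

Lemma revp0 m : revp m 0 = 0.
Proof. by apply/polyP=> i; rewrite coef_revp !coef0 if_same. Qed.

Lemma revp_sum m (I : Type) (s : seq I) (G : I -> {poly R}) :
  revp m (\sum_(i <- s) G i) = \sum_(i <- s) revp m (G i).
Proof. exact: (big_morph _ (revpD m) (revp0 m)). Qed.

Lemma revpZXn m c i : (i <= m)%N -> revp m (c *: 'X^i) = c *: 'X^(m - i).
Proof.
move=> im; apply/polyP=> j; rewrite coef_revp !coefZ !coefXn.
case: ifP => jm; first by congr (_ * _%:R); lia.
by rewrite (_ : (j == m - i)%N = false) ?mulr0 //; lia.
Qed.

Lemma poly_sum_coef g N : (size g <= N)%N -> g = \sum_(i < N) g`_i *: 'X^i.
Proof.
move=> gN; apply/polyP=> i; rewrite -poly_def coef_poly.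
by case: ltnP => // Ni; rewrite nth_default // (leq_trans gN).
Qed.

Lemma revpM m1 m2 g h : (size g <= m1.+1)%N -> (size h <= m2.+1)%N ->
  revp (m1 + m2) (g * h) = revp m1 g * revp m2 h.
Proof.
move=> /poly_sum_coef-> /poly_sum_coef->.
rewrite mulr_suml !revp_sum mulr_suml; apply: eq_bigr => i _.
rewrite mulr_sumr revp_sum mulr_sumr; apply: eq_bigr => j _.
have im : (i <= m1)%N by rewrite -ltnS.
have jm : (j <= m2)%N by rewrite -ltnS.
rewrite !revpZXn // -!scalerAl -!scalerAr !scalerA -!exprD revpZXn ?leq_add //.
by congr (_ *: 'X^_); lia.
Qed.

Lemma revp_prod_XsubC (s : seq R) :
  revp (size s) (\prod_(b <- s) ('X - b%:P)) = \prod_(b <- s) (1 - b *: 'X).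
Proof.
elim: s => [|b s IH].
  by rewrite !big_nil; apply/polyP=> -[|i]; rewrite coef_revp ?coef1.
rewrite !big_cons -IH (_ : size _ = 1 + size s)%N // revpM ?size_XsubC ?size_prod_XsubC //.
congr (_ * _); apply/polyP=> i; rewrite coef_revp !coefB coef1 coefZ coefX coefC.
by case: i => [|[|i]] //=; rewrite ?coefX /= ?mulr0 ?subr0 ?mulr1 ?sub0r.
Qed.

Lemma revp_lead m g : g \is monic -> size g = m.+1 -> (revp m g)`_0 = 1.
Proof. by move=> /monicP gm gs; rewrite coef_revp subn0 -gm /lead_coef gs. Qed.

End ReversedPolynomial.

Lemma revp_map (R S : comNzRingType) (f : {rmorphism R -> S}) m (g : {poly R}) :
  revp m (map_poly f g) = map_poly f (revp m g).
Proof.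
apply/polyP=> i; rewrite coef_revp !coef_map coef_revp.
by case: ifP; rewrite //= rmorph0.
Qed.

(** * Characteristic polynomials over a finite field *)

Section FiniteFields.
Variables (p n : nat) (F : finFieldType).
Hypotheses (p_pr : prime p) (cardF : #|F| = (p ^ n)%N).
Local Notation q := #|F|.

(** In the field [F[X]/(P)], which has [q^(deg P)] elements, the class of [X] is fixed by raising to
    that power. *)
Lemma irreducible_dvd_genPoly (P : {poly F}) :
  irreducible_poly P -> P \is monic -> P %| 'X^(q ^ (size P).-1) - 'X.
Proof.
move=> Pirr Pm; have hI : monic_irreducible_poly P by split.
have := expf_card (in_qpoly P 'X : {poly %/ P with hI}).
rewrite card_qfpoly => e.
have : in_qpoly P ('X^(q ^ (size P).-1) - 'X) = 0.
  by apply/eqP; rewrite rmorphB rmorphXn subr_eq0; apply/eqP; exact: e.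
move/val_eqP; rewrite /= -Pdiv.IdomainMonic.modpE ?monic_mk_monic //.
by rewrite mk_monicE.
Qed.

Lemma genPoly_dvd (a b : nat) :
  ('X^(q ^ a) - 'X : {poly F}) %| 'X^(q ^ (a * b)) - 'X.
Proof.
elim: b => [|b IH]; first by rewrite muln0 expn0 expr1 subrr dvdp0.
have -> : 'X^(q ^ (a * b.+1)) - 'X =
   ('X^(q ^ (a * b)) ^+ (q ^ a) - 'X ^+ (q ^ a)) + ('X^(q ^ a) - 'X) :> {poly F}.
  by rewrite addrA subrK -exprM -expnD mulnS addnC.
by rewrite dvdp_addl ?dvdpp // subrXX dvdp_mulr.
Qed.

Section Extension.
Variables (K : finFieldType) (iota : {rmorphism F -> K}).
Implicit Types (a x y : K) (k : nat).

Definition desc y : F := odflt 0 [pick u | iota u == y].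

Lemma descK : cancel iota desc.
Proof.
move=> u; rewrite /desc; case: pickP => [v /eqP/fmorph_inj //|/(_ u)].
by rewrite eqxx.
Qed.

Lemma desc0 : desc 0 = 0.
Proof. by rewrite -[X in desc X](rmorph0 iota) descK. Qed.

(** [X^q - X] is the product of all [X - u] with [u] in [F], so its roots in [K] come from [F]. *)
Lemma desc_fixed y : y ^+ q = y -> iota (desc y) = y.
Proof.
move=> yq; suff [u <-] : exists u, iota u = y by rewrite descK.
have := congr1 (fun g => (map_poly iota g).[y]) (finField_genPoly F).
rewrite rmorphB rmorphXn /= map_polyX !hornerE yq subrr => /esym/eqP.
rewrite rmorph_prod horner_prod => /prodf_eq0[u _].
by rewrite /= map_polyXsubC hornerXsubC subr_eq0 => /eqP->; exists u.
Qed.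

Lemma pchar_ext : p \in [pchar K].
Proof.
by rewrite (fmorph_pchar iota) (card_finPcharP cardF p_pr).
Qed.

Lemma frob_rmorphism m : exists f : {rmorphism K -> K}, f =1 (fun x => x ^+ (p ^ m)).
Proof.
elim: m => [|m [f fE]]; first by exists idfun => x; rewrite expr1.
exists (pFrobenius_aut pchar_ext \o f : {rmorphism K -> K}) => x /=.
by rewrite pFrobenius_autE fE -exprM expnSr.
Qed.

Lemma frobq_rmorphism j :
  exists f : {rmorphism K -> K}, f =1 (fun x => x ^+ (q ^ j)).
Proof. by rewrite cardF -expnM; apply: frob_rmorphism. Qed.

Lemma frobq_iota j (u : F) : iota u ^+ (q ^ j) = iota u.
Proof.
elim: j => [|j IH]; first by rewrite expr1.
by rewrite expnS exprM -rmorphXn expf_card.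
Qed.

Lemma map_desc (g : {poly K}) :
  (forall i, g`_i ^+ q = g`_i) -> map_poly iota (map_poly desc g) = g.
Proof.
by move=> gq; apply/polyP=> i; rewrite coef_map coef_map_id0 ?desc0 /= ?desc_fixed.
Qed.

(** For [K] of degree [k] over [F] this is the characteristic polynomial of [a]: conjugates are
    taken with multiplicity and the coefficients are pulled back to [F]. *)
Definition charF k a : {poly F} :=
  map_poly desc (\prod_(j < k) ('X - (a ^+ (q ^ j))%:P)).

(** Raising to the power [q] permutes the factors cyclically, hence fixes the coefficients of the
    product. *)
Lemma map_charF k a : a ^+ (q ^ k) = a ->
  map_poly iota (charF k a) = \prod_(j < k) ('X - (a ^+ (q ^ j))%:P).
Proof.
move=> ak; apply: map_desc => i; have [f fE1] := frobq_rmorphism 1.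
have fE x : f x = x ^+ q by rewrite fE1 expn1.
rewrite -fE -coef_map; congr nth; congr polyseq.
rewrite rmorph_prod; case: k ak => [|k] ak; first by rewrite !big_ord0.
rewrite big_ord_recr big_ord_recl mulrC /=; congr (_ * _).
  by apply: eq_bigr => j _; rewrite map_polyXsubC fE -exprM -expnSr.
by rewrite map_polyXsubC fE -exprM -expnSr ak expr1.
Qed.

Lemma conj_prodE k a : \prod_(j < k) ('X - (a ^+ (q ^ j))%:P) =
  \prod_(b <- mkseq (fun j => a ^+ (q ^ j)) k) ('X - b%:P).
Proof. by rewrite big_map -[in RHS](subn0 k) big_mkord. Qed.

Lemma size_charF k a : a ^+ (q ^ k) = a -> size (charF k a) = k.+1.
Proof.
move=> ak; rewrite -(size_map_poly iota) map_charF // conj_prodE.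
by rewrite size_prod_XsubC size_mkseq.
Qed.

Lemma monic_charF k a : a ^+ (q ^ k) = a -> charF k a \is monic.
Proof.
move=> ak; rewrite -(map_monic iota) map_charF // conj_prodE.
exact: monic_prod_XsubC.
Qed.

Lemma ps_charF k a i : a ^+ (q ^ k) = a ->
  iota (ps (revp k (charF k a)) i.+1) = \sum_(j < k) a ^+ (q ^ j) ^+ i.+1.
Proof.
move=> ak; rewrite -ps_map -revp_map map_charF // conj_prodE.
set s := mkseq _ _; have <- : size s = k by rewrite size_mkseq.
rewrite revp_prod_XsubC ps_prod /s size_mkseq.
by rewrite big_map -[X in seq.iota 0 X](subn0 k) big_mkord.
Qed.

Lemma root_conj (P : {poly F}) a j :
  root (map_poly iota P) (a ^+ (q ^ j)) = root (map_poly iota P) a.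
Proof.
have [f fE] := frobq_rmorphism j; rewrite -fE.
have {1}-> : map_poly iota P = map_poly f (map_poly iota P).
  by apply/polyP=> i; rewrite [in RHS]coef_map !coef_map /= fE frobq_iota.
exact: fmorph_root.
Qed.

Lemma conj_period a e m : a ^+ (q ^ e) = a -> a ^+ (q ^ (e * m)) = a.
Proof.
move=> ae; elim: m => [|m IH]; first by rewrite muln0 expr1.
by rewrite mulnS expnD exprM ae.
Qed.

Lemma charF_coprime k a (P : {poly F}) : a ^+ (q ^ k) = a ->
  ~~ root (map_poly iota P) a -> coprimep (charF k a) P.
Proof.
move=> ak nr; rewrite -(coprimep_map iota) map_charF //.
apply: (big_ind (fun g => coprimep g (map_poly iota P))).
- exact: coprime1p.
- by move=> g h; rewrite coprimepMl => -> ->.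
by move=> j _; rewrite coprimep_sym coprimep_XsubC root_conj.
Qed.

(** Take the least positive period [e]. The remainder of [k] modulo [e] is again a period, hence 0;
    a repetition within the orbit would give a shorter period, as Frobenius is injective. *)
Lemma conj_orbit k a : (0 < k)%N -> a ^+ (q ^ k) = a ->
  exists e, [/\ (0 < e)%N, (e %| k)%N, a ^+ (q ^ e) = a &
                uniq (mkseq (fun j => a ^+ (q ^ j)) e)].
Proof.
move=> k0 ak.
have ex : exists e, (0 < e)%N && (a ^+ (q ^ e) == a) by exists k; rewrite k0 ak eqxx.
have [e /andP[e0 /eqP ae] emin] := ex_minnP ex.
exists e; split=> //.
  have lt := ltn_pmod k e0; have := emin (k %% e)%N.
  rewrite {1}(divn_eq k e) mulnC expnD exprM conj_period // in ak.
  by rewrite ak eqxx andbT /dvdn; case: posnP => // _ /(_ isT); rewrite leqNgt lt.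
apply/(mkseq_uniqP _ _) => i j.
wlog ij : i j / (i <= j)%N.
  move=> W; case/orP: (leq_total i j) => [/W //|/W{}W hi hj e1].
  exact/esym/W.
rewrite !inE => _ je /=; rewrite -{1}(subnK ij) expnD exprM.
have [f fE] := frobq_rmorphism i; rewrite -!fE => /(fmorph_inj f) aji.
have := emin (j - i)%N; rewrite -aji eqxx andbT.
by case: (posnP (j - i)) => [|_ /(_ isT)]; lia.
Qed.

(** The orbit polynomial of [a] has distinct roots, all of them roots of [P], so it divides [P] and
    equals it by irreducibility. The [k] conjugates run through the orbit [k / deg P] times. *)
Lemma charF_irreducible k a (P : {poly F}) :
  irreducible_poly P -> P \is monic -> (0 < k)%N -> a ^+ (q ^ k) = a ->
  root (map_poly iota P) a ->
  (((size P).-1 %| k)%N * (charF k a = P ^+ (k %/ (size P).-1)))%type.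
Proof.
move=> Pirr Pm k0 ak ra; have [e [e0 ek ae ue]] := conj_orbit k0 ak.
have cP : charF e a = P.
  have d : charF e a %| P.
    rewrite -(dvdp_map iota) map_charF // conj_prodE; apply: uniq_roots_dvdp.
      by apply/allP=> _ /mapP[j _ ->]; rewrite root_conj.
    by rewrite uniq_rootsE.
  apply/eqP; rewrite -eqp_monic ?monic_charF //.
  by apply: Pirr.2 => //; rewrite size_charF //; lia.
have sP : (size P).-1 = e by rewrite -cP size_charF.
rewrite sP; split=> //; apply: (map_poly_inj iota).
rewrite map_charF // -cP rmorphXn /= map_charF //.
have pow m : \prod_(j < e * m) ('X - (a ^+ (q ^ j))%:P) =
             (\prod_(j < e) ('X - (a ^+ (q ^ j))%:P)) ^+ m.
  elim: m => [|m IH]; first by rewrite muln0 big_ord0.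
  rewrite mulnS big_split_ord exprS -IH /=; congr (_ * _).
  by apply: eq_bigr => j _; rewrite expnD exprM ae.
by rewrite -pow mulnC divnK.
Qed.

Lemma sum_conj e m i a : a ^+ (q ^ e) = a ->
  \sum_(j < e * m) a ^+ (q ^ j) ^+ i = (\sum_(j < e) a ^+ (q ^ j) ^+ i) *+ m.
Proof.
move=> ae; elim: m => [|m IH]; first by rewrite muln0 big_ord0.
rewrite mulnS big_split_ord mulrS -IH /=; congr (_ + _).
by apply: eq_bigr => j _; rewrite expnD exprM ae.
Qed.

(** [X^#|K| - X] is a product of distinct linear factors, and so is each of its divisors up to a
    constant. *)
Lemma card_roots_dvd (g : {poly K}) : g %| 'X^#|K| - 'X ->
  #|[pred a | root g a]| = (size g).-1.
Proof.
rewrite finField_genPoly -big_enum => /dvdp_prod_XsubC[m gm].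
rewrite (eqp_size gm) size_prod_XsubC /=.
have um : uniq (mask m (enum K)) by rewrite mask_uniq ?enum_uniq.
rewrite -(card_uniqP um); apply: eq_card => a.
by rewrite inE (eqp_root gm) root_prod_XsubC.
Qed.

Lemma card_roots_irreducible (P : {poly F}) b :
  irreducible_poly P -> P \is monic -> #|K| = (q ^ ((size P).-1 * b))%N ->
  #|[pred a | root (map_poly iota P) a]| = (size P).-1.
Proof.
move=> Pirr Pm cK; rewrite card_roots_dvd ?size_map_poly //.
have := dvdp_trans (irreducible_dvd_genPoly Pirr Pm) (genPoly_dvd (size P).-1 b).
by rewrite -(dvdp_map iota) cK rmorphB rmorphXn /= map_polyX.
Qed.

Lemma card_fixed s b : #|K| = (q ^ (s * b))%N -> (0 < s)%N ->
  #|[pred a : K | a ^+ (q ^ s) == a]| = (q ^ s)%N.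
Proof.
move=> cK s0; have q1 : (1 < q)%N := card_finNzRing_gt1 F.
have q2 : (1 < q ^ s)%N by rewrite -(exp1n s) ltn_exp2r.
have := genPoly_dvd s b.
rewrite -(dvdp_map iota) !rmorphB !rmorphXn /= map_polyX -cK => /card_roots_dvd.
rewrite size_polyDl ?size_polyXn ?size_polyN ?size_polyX ?ltnS //= => e; rewrite -[RHS]e.
by apply: eq_card => a; rewrite !inE rootE !hornerE subr_eq0.
Qed.

End Extension.
End FiniteFields.

(** * Monic polynomials over a finite field *)

Section Monics.
Variable F : finFieldType.

Definition monics (m : nat) : seq {poly F} :=
  [seq 'X^m + rVpoly v | v <- enum 'rV[F]_m].

Lemma mem_monics m g : (g \in monics m) = (g \is monic) && (size g == m.+1).
Proof.
apply/mapP/andP => [[v _ ->]|[gm /eqP gs]].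
  have vs : (size (rVpoly v) < m.+1)%N by rewrite ltnS size_poly.
  by rewrite monicE lead_coefDl ?size_polyXn // lead_coefXn size_polyDl ?size_polyXn.
exists (poly_rV (g - 'X^m)); rewrite ?mem_enum // poly_rV_K ?subrKC //.
apply/leq_sizeP => i; rewrite leq_eqVlt => /orP[/eqP <-|mi]; rewrite coefB coefXn.
  by move/monicP: gm; rewrite /lead_coef gs eqxx /= => ->; rewrite subrr.
by rewrite nth_default ?gs // (gtn_eqF mi) subr0.
Qed.

Lemma monics_uniq m : uniq (monics m).
Proof.
by rewrite map_inj_uniq ?enum_uniq // => u v /addrI /(can_inj rVpolyK).
Qed.

Lemma exists_irreducible_factor (g : {poly F}) : (1 < size g)%N ->
  exists P, [/\ irreducible_poly P, P \is monic & P %| g].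
Proof.
have [N] := ubnP (size g); elim: N g => // N IH g gN g1.
have [gi|] := boolP (irreducibleb g).
  have l0 : lead_coef g != 0 by rewrite lead_coef_eq0 -size_poly_gt0 ltnW.
  have lV0 : (lead_coef g)^-1 != 0 by rewrite invr_eq0.
  exists ((lead_coef g)^-1 *: g); split; last by rewrite dvdpZl.
    have [_ gP] := irreducibleP _ gi; split=> [|d d1]; first by rewrite size_scale.
    by rewrite dvdpZr // => /gP-/(_ d1); rewrite (eqp_rtrans (eqp_scale _ lV0)).
  by rewrite monicE lead_coefZ mulVf.
rewrite /irreducibleb g1 /= negb_forall => /existsP[d].
rewrite negb_imply -Pdiv.Idomain.dvdpE -ltnNge => /andP[dg d1].
have [|P [Pi Pm Pd]] := IH d _ d1.
  by apply: leq_ltn_trans (size_npoly d) _; rewrite prednK ?(ltnW g1).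
by exists P; split=> //; apply: dvdp_trans dg.
Qed.

End Monics.

(** * Counting field elements by their characteristic polynomials *)

Section CountConjugates.
Variables (p n : nat) (F : finFieldType) (K : nat -> finFieldType).
Variable iota : forall s, {rmorphism F -> K s}.
Hypotheses (p_pr : prime p) (cardF : #|F| = (p ^ n)%N).
Hypothesis cardK : forall s, (0 < s)%N -> #|K s| = (#|F| ^ s)%N.
Local Notation q := #|F|.

Definition cdvd k (g : {poly F}) : nat :=
  #|[pred a : K k.+1 | charF (iota k.+1) k.+1 a %| g]|.

Lemma frobK k (a : K k.+1) : a ^+ (q ^ k.+1) = a.
Proof. by rewrite -cardK // expf_card. Qed.

(** Let [e = deg P] and let [P^j] be the exact power of [P] in [h]. If [a] is not a root of [P], its
    characteristic polynomial is coprime to [P] and the extra factor changes nothing. If it is a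
    root, that polynomial is some [P^i], and only [i = j + 1] is new: this adds the [e] roots of [P]
    in the field of degree [e (j + 1)]. *)
Lemma count_charF_mul (P h : {poly F}) M :
    irreducible_poly P -> P \is monic -> h \is monic ->
    ((size P).-1 + (size h).-1 <= M)%N ->
  (\sum_(k < M) cdvd k (P * h)%R = (size P).-1 + \sum_(k < M) cdvd k h)%N.
Proof.
move=> Pi Pm hm hM; set e := (size P).-1.
have sP : (1 < size P)%N by case: Pi.
have P0 : P != 0 by rewrite monic_neq0.
have h0 : h != 0 by rewrite monic_neq0.
have dvd_size i : P ^+ i %| h -> (e * i <= (size h).-1)%N.
  move=> /dvdp_leq-/(_ h0); have := size_exp P i; rewrite -/e => <-.
  by case: (size h) => // [|s]; case: (size _).
have ex0 : exists i, P ^+ i %| h by exists 0%N; rewrite expr0 dvd1p.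
have ub i : P ^+ i %| h -> (i <= (size h).-1)%N.
  by move/dvd_size; apply: leq_trans; rewrite leq_pmull // /e; lia.
have [j jh jmax] := ex_maxnP ex0 ub.
have Ph i : (P ^+ i %| h) = (i <= j)%N.
  apply/idP/idP => [/jmax //|ij]; apply: dvdp_trans jh; exact: dvdp_exp2l.
have PPh i : (P ^+ i %| P * h) = (i <= j.+1)%N.
  by case: i => [|i]; rewrite ?expr0 ?dvd1p // exprS dvdp_mul2l // Ph.
have step (k : 'I_M) : cdvd k (P * h) =
    (cdvd k h + (k == (e * j.+1).-1 :> nat) * e)%N.
  have -> : ((k == (e * j.+1).-1 :> nat) * e)%N =
      (\sum_(a : K k.+1) ((k == (e * j.+1).-1 :> nat) &&
                          root (map_poly (iota k.+1) P) a))%N.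
    case: eqP => [kE|_]; last by rewrite big1.
    rewrite mul1n /e -(card_roots_irreducible (iota k.+1) (b := j.+1)) //.
      by rewrite -sum1_card big_mkcond /=; apply: eq_bigr => a _; rewrite inE; case: root.
    by rewrite cardK // kE prednK // muln_gt0 /e; lia.
  rewrite /cdvd -!sum1_card !(big_mkcond (fun a => a \in _)) -big_split.
  apply: eq_bigr => a _; rewrite !inE.
  have ak := frobK a.
  have [ra|nra] := boolP (root _ a); last first.
    by rewrite Gauss_dvdpr ?(charF_coprime p_pr cardF) // andbF /= addn0.
  have [ek ->] := charF_irreducible p_pr cardF Pi Pm (ltn0Sn k) ak ra.
  rewrite -/e in ek *; rewrite Ph PPh andbT.
  have e0 : (0 < e)%N by rewrite /e; lia.
  have -> : (k == (e * j.+1).-1 :> nat) = (k.+1 %/ e == j.+1)%N.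
    rewrite -eqSS prednK ?muln_gt0 ?e0 // -{1}(divnK ek) mulnC.
    by rewrite eqn_pmul2l.
  by rewrite -[(_ <= j)%N]ltnS; case: ltngtP.
rewrite (eq_bigr _ (fun k _ => step k)) big_split /= addnC; congr (_ + _)%N.
(* The degree [e (j + 1)] is among those summed: it is at most [deg P + deg h], as [P^j] divides
   [h]. *)
have lM : ((e * j.+1).-1 < M)%N.
  have := dvd_size _ jh; rewrite mulnS; move: hM; rewrite -/e.
  have e0 : (0 < e)%N by rewrite /e; lia.
  by lia.
rewrite (bigD1 (Ordinal lM)) //= eqxx mul1n big1 ?addn0 // => k kn.
by rewrite (negbTE (kn : nat_of_ord k != _)).
Qed.

(** Irreducible factors are removed one by one, each contributing its degree. [M] is only an upper
    bound, so it stays fixed in the induction. *)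
Lemma count_charF (g : {poly F}) M : g \is monic -> ((size g).-1 <= M)%N ->
  (\sum_(k < M) cdvd k g = (size g).-1)%N.
Proof.
have [N] := ubnP (size g); elim: N g => // N IH g gN gm gM.
have g0 : g != 0 by rewrite monic_neq0.
have [g1|g1] := leqP (size g) 1.
  rewrite big1 => [|k _]; first by lia.
  rewrite /cdvd; apply: eq_card0 => a; rewrite inE; apply: contraTF g1 => /dvdp_leq-/(_ g0).
  by rewrite (size_charF p_pr cardF) ?frobK // -ltnNge; apply: leq_trans.
have [P [Pi Pm /dvdpP[h gE]]] := exists_irreducible_factor g1.
have hm : h \is monic by rewrite -(monicMl _ Pm) mulrC -gE.
have P1 : (1 < size P)%N by case: Pi.
have h1 : (0 < size h)%N by rewrite size_poly_gt0 monic_neq0.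
have sg : (size g).-1 = ((size P).-1 + (size h).-1)%N.
  rewrite gE size_Mmonic ?monic_neq0 //; move: P1 h1.
  by set a := size P; set b := size h; lia.
have hM : ((size P).-1 + (size h).-1 <= M)%N by rewrite -sg.
have hN : (size h < N)%N.
  rewrite ltnS in gN; apply: leq_trans gN; rewrite -(prednK (ltnW g1)) sg.
  by move: P1 h1; set a := size P; set b := size h; lia.
rewrite sg gE mulrC count_charF_mul // IH //.
exact: leq_trans (leq_addl _ _) hM.
Qed.

End CountConjugates.

(** * The L-function of an additive character *)

Section CharacterSums.
Variables (p n : nat) (F : finFieldType) (K : nat -> finFieldType).
Variable iota : forall s, {rmorphism F -> K s}.
Hypotheses (p_pr : prime p) (cardF : #|F| = (p ^ n)%N).
Hypothesis cardK : forall s, (0 < s)%N -> #|K s| = (#|F| ^ s)%N.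
Local Notation q := #|F|.

Variable Theta : F -> algC.
Hypothesis Theta0 : Theta 0 = 1.
Hypothesis ThetaD : {morph Theta : x y / x + y >-> x * y}.
Hypothesis Theta_neq1 : exists x, Theta x != 1.

(** For [c != 0], after rescaling, translation by an [x] with [Theta x != 1] multiplies the sum by
    [Theta x] without changing it. *)
Lemma sum_Theta (c : F) : \sum_(t : F) Theta (c * t) = (c == 0)%:R * q%:R.
Proof.
have [->|c0] := eqVneq c 0.
  rewrite mul1r (eq_bigr (fun=> 1)) => [|t _]; last by rewrite mul0r.
  by rewrite sumr_const.
rewrite mul0r; have [x x1] := Theta_neq1.
rewrite (reindex_inj (mulfI (invr_neq0 c0))) /=.
under eq_bigr => t _ do rewrite mulVKf //.
apply/eqP; rewrite -(mulrI_eq0 _ (@mulfI _ (Theta x - 1) _)) ?subr_eq0 //.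
rewrite mulrBl mul1r subr_eq0 mulr_sumr; apply/eqP.
rewrite [RHS](reindex_inj (addrI x)); apply: eq_bigr => t _; exact/esym/ThetaD.
Qed.

Lemma Theta_sum (I : Type) (s : seq I) (P : pred I) (G : I -> F) :
  Theta (\sum_(i <- s | P i) G i) = \prod_(i <- s | P i) Theta (G i).
Proof. exact: (big_morph Theta ThetaD Theta0). Qed.

(* The coefficient of X^(i+1) of the polynomial of degree d is u i; its constant term is 0. *)
Variables (d : nat) (u : nat -> F).

Definition chi m (g : {poly F}) : algC :=
  Theta (\sum_(i < d) u i * ps (revp m g) i.+1).

Lemma chiM m1 m2 g h : g \in monics F m1 -> h \in monics F m2 ->
  chi (m1 + m2) (g * h) = chi m1 g * chi m2 h.
Proof.
rewrite !mem_monics => /andP[gm /eqP gs] /andP[hm /eqP hs].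
rewrite /chi -ThetaD -big_split; congr (Theta _); apply: eq_bigr => i _ /=.
by rewrite revpM ?gs ?hs // psM ?revp_lead // mulrDr.
Qed.

Definition chisum m : algC := \sum_(g <- monics F m) chi m g.
Definition conjsum k : algC := \sum_(a : K k) chi k (charF (iota k) k a).

Lemma charF_monics k (a : K k.+1) :
  charF (iota k.+1) k.+1 a \in monics F k.+1.
Proof.
have ak := frobK cardK a.
by rewrite mem_monics (monic_charF p_pr cardF) // (size_charF p_pr cardF) ?eqxx.
Qed.

Lemma perm_multiples k m (c : {poly F}) : c \in monics F k ->
  perm_eq [seq c * h | h <- monics F m] [seq g <- monics F (k + m) | c %| g].
Proof.
rewrite mem_monics => /andP[cm /eqP cs]; have c0 := monic_neq0 cm.
apply: uniq_perm; rewrite ?filter_uniq ?monics_uniq //.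
  by rewrite map_inj_uniq ?monics_uniq //; apply: mulfI.
move=> g; rewrite mem_filter mem_monics; apply/mapP/and3P.
  move=> [h]; rewrite mem_monics => /andP[hm /eqP hs] ->.
  by rewrite dvdp_mulr // monicMl // size_Mmonic ?monic_neq0 // cs hs addSn addnS /=.
case=> /dvdpP[h ->]; rewrite mulrC monicMl // => hm; rewrite mulrC.
rewrite size_Mmonic ?monic_neq0 // cs => hs; exists h; rewrite 1?mulrC // mem_monics hm.
by move: hs; set s := size h; lia.
Qed.

Lemma sum_multiples k m (c : {poly F}) : c \in monics F k ->
  \sum_(g <- monics F (k + m) | c %| g) chi (k + m) g = chi k c * chisum m.
Proof.
move=> cm; rewrite -big_filter -(perm_big _ (perm_multiples _ cm)) big_map mulr_sumr.
by apply: eq_big_seq => h hm; rewrite chiM.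
Qed.

Lemma chisum0 : chisum 0 = 1.
Proof.
rewrite /chisum (perm_big [:: 1]); last first.
  apply: uniq_perm; rewrite ?monics_uniq // => g; rewrite mem_monics inE.
  apply/andP/eqP => [[gm /eqP g1]|->]; last by rewrite monic1 size_poly1.
  move/eqP: g1 => /size_poly1P[c _ gc]; move: gm; rewrite gc monicE lead_coefC.
  by move/eqP->.
rewrite big_seq1 /chi big1 // => i _.
have -> : revp 0 1 = 1 :> {poly F}.
  by apply/polyP=> -[|j]; rewrite coef_revp ?coef1.
by rewrite ps1 mulr0.
Qed.

(** For each [g] the factor [m + 1] is replaced by the number of [a] whose characteristic polynomial
    [c] divides [g]. Exchanging the sums and writing [g = c h], multiplicativity of [chi] separates
    the two factors. *)
Lemma chisum_rec m : m.+1%:R * chisum m.+1 =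
  \sum_(k < m.+1) conjsum k.+1 * chisum (m - k).
Proof.
have -> : m.+1%:R * chisum m.+1 = \sum_(g <- monics F m.+1) \sum_(k < m.+1)
   \sum_(a : K k.+1 | charF (iota k.+1) k.+1 a %| g) chi m.+1 g.
  rewrite mulr_sumr; apply: eq_big_seq => g; rewrite mem_monics => /andP[gm /eqP gs].
  have := count_charF iota p_pr cardF cardK (M := m.+1) gm; rewrite gs => /(_ (leqnn _)) /= cnt.
  rewrite -{1}cnt natr_sum mulr_suml; apply: eq_bigr => k _.
  by rewrite mulr_natl /cdvd -sumr_const; apply: eq_bigl => a; rewrite !inE.
rewrite exchange_big; apply: eq_bigr => k _ /=.
rewrite (exchange_big_dep xpredT) //= mulr_suml; apply: eq_bigr => a _.
have := sum_multiples (m - k) (charF_monics a).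
by rewrite (_ : k.+1 + (m - k) = m.+1)%N //; have := ltn_ord k; lia.
Qed.

(** The sum is averaged over all shifts [t] of the coefficient of [X^(m-d)]. Such a shift multiplies
    [chi m g] by [Theta] at [-d u_(d-1) t], and these values sum to 0 over [t]. *)
Lemma chisum_eq0 m : (0 < d <= m)%N -> (d%:R : F) != 0 -> u d.-1 != 0 -> chisum m = 0.
Proof.
clear p_pr cardF cardK; move=> /andP[d0 dm] dF ud.
have shiftm t g : g \in monics F m -> g + t *: 'X^(m - d) \in monics F m.
  rewrite !mem_monics => /andP[gm /eqP gs].
  have sz : (size (t *: 'X^(m - d) : {poly F}) < size g)%N.
    by apply: leq_ltn_trans (size_scale_leq _ _) _; rewrite size_polyXn gs; lia.
  by rewrite size_polyDl // gs eqxx andbT monicE lead_coefDl.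
have shift t : chisum m = \sum_(g <- monics F m) chi m (g + t *: 'X^(m - d)).
  rewrite -(big_map (fun g => g + t *: 'X^(m - d)) xpredT (chi m)).
  apply: perm_big; apply: uniq_perm; rewrite ?monics_uniq //.
    by rewrite map_inj_uniq ?monics_uniq //; apply: addIr.
  move=> g; apply/idP/mapP => [gm|[h hm ->]]; last exact: shiftm.
  exists (g - t *: 'X^(m - d)); last by rewrite subrK.
  by rewrite -scaleNr; apply: shiftm.
have q0 : (q%:R : algC) != 0 by rewrite pnatr_eq0 -lt0n (ltnW (card_finNzRing_gt1 F)).
apply: (mulfI q0); rewrite mulr0.
have -> : q%:R * chisum m = \sum_(t : F) chisum m by rewrite sumr_const mulr_natl.
under eq_bigr => t _ do rewrite (shift t).
rewrite exchange_big big_seq big1 // => g gm.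
have chig t : chi m (g + t *: 'X^(m - d)) = chi m g * Theta (- (d%:R * u d.-1) * t).
  move: gm; rewrite mem_monics => /andP[gm /eqP gs].
  rewrite /chi -ThetaD; congr (Theta _).
  rewrite revpD revpZXn ?leq_subr // subKn //.
  have lt : (d.-1 < d)%N by rewrite prednK.
  rewrite (bigD1 (Ordinal lt)) // [in RHS](bigD1 (Ordinal lt)) //= ps_shift ?revp_lead //.
  rewrite prednK // eqxx mul1r -mulr_natr.
  rewrite (eq_bigr (fun i : 'I_d => u i * ps (revp m g) i.+1)); first by ring.
  move=> i ni; rewrite ps_shift ?revp_lead // (_ : (i.+1 == d) = false) ?mul0r ?subr0 //.
  by apply: contraNF ni => /eqP id; apply/eqP/val_inj => /=; lia.
under eq_bigr => t _ do rewrite chig.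
by rewrite -mulr_sumr sum_Theta oppr_eq0 mulf_eq0 (negbTE dF) (negbTE ud) mul0r mulr0.
Qed.

End CharacterSums.

(** * The trace character and the coefficients of L *)

Section TraceCharacter.
Variables (p n : nat) (F : finFieldType) (K : nat -> finFieldType).
Variable iota : forall s, {rmorphism F -> K s}.
Variable psi : 'F_p -> algC.
Hypotheses (p_pr : prime p) (cardF : #|F| = (p ^ n)%N).
Hypothesis cardK : forall s, (0 < s)%N -> #|K s| = (#|F| ^ s)%N.
Hypothesis psi0 : psi 0 = 1.
Hypothesis psiD : {morph psi : x y / x + y >-> x * y}.
Hypothesis psi_neq1 : exists x, psi x != 1.
Local Notation q := #|F|.

Lemma prime_embedding : exists j : {rmorphism 'F_p -> F}, forall k : 'F_p, j k = (val k)%:R.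
Proof.
have chF := card_finPcharP cardF p_pr.
have e : exists j : {rmorphism 'F_p -> pPrimeCharType chF},
    forall k : 'F_p, j k = (val k)%:R.
  by exists (in_alg (pPrimeCharType chF)) => k; apply: (mulr1 ((val k)%:R : F)).
exact: e.
Qed.

Variable j : {rmorphism 'F_p -> F}.
Hypothesis jE : forall k : 'F_p, j k = (val k)%:R.

(** The absolute trace, with its value kept in [F]; [desc j] brings it to ['F_p]. *)
Definition abstr (x : F) : F := \sum_(i < n) x ^+ (p ^ i).
Definition tracechar (x : F) : algC := psi (desc j (abstr x)).

Lemma exprDp (L : finFieldType) (f : {rmorphism F -> L}) (x y : L) i :
  (x + y) ^+ (p ^ i) = x ^+ (p ^ i) + y ^+ (p ^ i).
Proof.
have [g gE] := frob_rmorphism p_pr cardF f i.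
by rewrite -!gE rmorphD.
Qed.

Lemma abstrD : {morph abstr : x y / x + y}.
Proof.
move=> x y; rewrite /abstr -big_split; apply: eq_bigr => i _.
exact: (exprDp idfun).
Qed.

Lemma abstr_prime x : abstr x ^+ #|'F_p| = abstr x.
Proof.
rewrite card_Fp //; have [g gE] := frob_rmorphism p_pr cardF idfun 1.
have gp y : g y = y ^+ p by rewrite gE expn1.
rewrite -gp /abstr rmorph_sum /=.
have := expf_card x; rewrite cardF; case: n => [|m] xq; first by rewrite !big_ord0.
rewrite big_ord_recr big_ord_recl addrC /= gp -exprM -expnSr xq expr1.
by congr (_ + _); apply: eq_bigr => i _; rewrite gp -exprM -expnSr.
Qed.

Lemma descD x y : x ^+ #|'F_p| = x -> y ^+ #|'F_p| = y ->
  desc j (x + y) = desc j x + desc j y.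
Proof.
by move=> xp yp; rewrite -[X in X + _](desc_fixed j xp) -[X in _ + X](desc_fixed j yp)
  -rmorphD !descK.
Qed.

Lemma tracechar0 : tracechar 0 = 1.
Proof.
rewrite /tracechar /abstr big1 ?desc0 // => i _.
by rewrite expr0n expn_eq0; case: p p_pr.
Qed.

Lemma tracecharD : {morph tracechar : x y / x + y >-> x * y}.
Proof. by move=> x y; rewrite /tracechar abstrD descD ?abstr_prime. Qed.

(** The trace is given by a nonzero polynomial of degree [p^(n-1)], which cannot vanish at all [p^n]
    elements. *)
Lemma abstr_neq0 : exists x, abstr x != 0.
Proof.
pose T : {poly F} := \sum_(i < n) 'X^(p ^ i).
have n0 : (0 < n)%N.
  by have := card_finNzRing_gt1 F; rewrite cardF; case: n.
have p1 := prime_gt1 p_pr.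
have T0 : T != 0.
  apply/eqP => /(congr1 (fun g : {poly F} => g`_1)); rewrite coef0 coef_sum.
  rewrite (bigD1 (Ordinal n0)) //= expn0 coefXn eqxx big1 => [|i i0].
    by rewrite addr0; apply/eqP; rewrite oner_eq0.
  rewrite coefXn (ltn_eqF _) // -{1}(expn0 p) ltn_exp2l // lt0n.
  exact: (i0 : nat_of_ord i != 0%N).
have sT : (size T <= p ^ n.-1 + 1)%N.
  apply: leq_trans (size_sum _ _ _) _; apply/bigmax_leqP => i _.
  by rewrite size_polyXn addn1 ltnS leq_exp2l //; have := ltn_ord i; lia.
have [x|] := pickP (fun x => abstr x != 0); first by exists x.
move=> all0; exfalso.
have := max_poly_roots T0 (rs := enum F); rewrite enum_uniq -cardE cardF => H.
have {}H : (p ^ n < size T)%N.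
  apply: H => //; apply/allP => x _; have /negbFE/eqP := all0 x.
  rewrite rootE horner_sum /abstr => a0; apply/eqP; rewrite -[RHS]a0.
  by apply: eq_bigr => i _; rewrite hornerXn.
have := leq_trans H sT; rewrite -{1}(prednK n0) expnS addn1 ltnS leqNgt.
by rewrite ltn_Pmull // expn_gt0 ltnW.
Qed.

(** The trace is linear over ['F_p] and nonzero, so it takes every value, in particular one where
    [psi] differs from 1. *)
Lemma tracechar_neq1 : exists x, tracechar x != 1.
Proof.
have [y y0] := psi_neq1; have [x x0] := abstr_neq0.
have tj c z : abstr (j c * z) = j c * abstr z.
  rewrite /abstr mulr_sumr; apply: eq_bigr => i _; rewrite exprMn; congr (_ * _).
  by have := frobq_iota j i c; rewrite card_Fp.
pose t := desc j (abstr x).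
have jt : j t = abstr x by apply/desc_fixed/abstr_prime.
have t0 : t != 0 by rewrite -(fmorph_eq0 j) jt.
by exists (j (y / t) * x); rewrite /tracechar tj -jt -rmorphM divfK // descK.
Qed.

(** Transitivity of the trace: the exponents below [n s] are grouped by their residue modulo [n]. *)
Lemma trFp_frob s (y : K s) :
  trFp p n y = \sum_(i < n) (\sum_(k < s) y ^+ (q ^ k)) ^+ (p ^ i).
Proof.
rewrite /trFp cardF.
have -> m : \sum_(i < n * m) y ^+ (p ^ i) =
    \sum_(i < n) (\sum_(k < m) y ^+ ((p ^ n) ^ k)) ^+ (p ^ i).
  elim: m y => [|m IH] y.
    rewrite muln0 big_ord0 big1 // => i _.
    by rewrite big_ord0 expr0n expn_eq0; case: p p_pr.
  rewrite mulnS big_split_ord /=.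
  under [X in _ + X]eq_bigr => i _ do rewrite expnD exprM.
  rewrite IH -big_split; apply: eq_bigr => i _ /=.
  rewrite big_ord_recl expr1 (exprDp (iota s)); congr (_ + _ ^+ _).
  by apply: eq_bigr => k _; rewrite -exprM -expnS.
by [].
Qed.

Lemma toFp_iota s x : toFp p (iota s x) = desc j x.
Proof.
rewrite /toFp /desc; congr odflt; apply: eq_pick => k.
by rewrite jE -(rmorph_nat (iota s)) (inj_eq (fmorph_inj _)).
Qed.

Lemma psi_trace s (y : K s) (x : F) : iota s x = \sum_(k < s) y ^+ (q ^ k) ->
  psi (toFp p (trFp p n y)) = tracechar x.
Proof.
move=> xE; rewrite trFp_frob -xE /tracechar -(toFp_iota s) /abstr.
by rewrite rmorph_sum; do 2 congr (_ _); apply: eq_bigr => i _; rewrite rmorphXn.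
Qed.

(** The relative trace of [f(a)] combines the traces of the powers [a^i], which are power sums of
    conjugates. As [f] has no constant term, the indices start at 1. *)
Lemma expsum_conjsum d (f : {poly F}) k : (size f <= d.+1)%N -> f`_0 = 0 ->
  expsum n iota psi f k.+1 = conjsum iota tracechar d (fun i => f`_i.+1) k.+1.
Proof.
move=> fs f0; apply: eq_bigr => a _.
have ak := frobK cardK a.
apply: psi_trace; rewrite rmorph_sum /=.
under eq_bigr => i _ do rewrite rmorphM (ps_charF p_pr cardF) // mulr_sumr.
rewrite exchange_big; apply: eq_bigr => i _ /=.
have [g gE] := frobq_rmorphism p_pr cardF (iota k.+1) i.
rewrite -!gE -horner_map /= -map_poly_comp /=.
rewrite (@horner_coef_wide _ d.+1) ?(leq_trans (size_poly _ _)) //.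
rewrite big_ord_recl coef_map /= f0 !rmorph0 mul0r add0r.
by apply: eq_bigr => l _; rewrite coef_map /= !gE frobq_iota.
Qed.

Lemma Lcoefs_nth (f : {poly F}) m i : (i <= m)%N ->
  nth 0 (Lcoefs n iota psi f m) i = Lcoef n iota psi f i.
Proof.
have sz k : size (Lcoefs n iota psi f k) = k.+1.
  by elim: k => //= k IH; rewrite size_rcons IH.
elim: m => [|m IH]; first by case: i.
rewrite leq_eqVlt => /orP[/eqP-> //|]; rewrite ltnS => im.
by rewrite /= nth_rcons sz ltnS im IH.
Qed.

Lemma Lcoef_rec (f : {poly F}) m : Lcoef n iota psi f m.+1 = m.+1%:R^-1 *
  \sum_(k < m.+1) expsum n iota psi f k.+1 * Lcoef n iota psi f (m - k).
Proof.
have sz k : size (Lcoefs n iota psi f k) = k.+1.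
  by elim: k => //= k IH; rewrite size_rcons IH.
rewrite {1}/Lcoef /= nth_rcons sz ltnn eqxx; congr (_ * _).
by apply: eq_bigr => k _; rewrite Lcoefs_nth ?leq_subr.
Qed.

Lemma Lcoef_chisum d (f : {poly F}) m : (size f <= d.+1)%N -> f`_0 = 0 ->
  Lcoef n iota psi f m = chisum tracechar d (fun i => f`_i.+1) m.
Proof.
move=> fs f0; have [N] := ubnP m; elim: N m => // N IH [|m] mN.
  by rewrite chisum0 // tracechar0.
rewrite Lcoef_rec; have m0 : (m.+1%:R : algC) != 0 by rewrite pnatr_eq0.
apply: (mulfI m0); rewrite mulVKf // (chisum_rec iota p_pr cardF cardK tracecharD).
apply: eq_bigr => k _; rewrite -(expsum_conjsum _ fs f0) IH //; lia.
Qed.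

(** Since the coefficients from index [d] on vanish, the recursion says that [L'/L] has the
    exponential sums as coefficients, so the power sums attached to [L] are their negatives.
    Factoring [Lrev] turns them into power sums of the numbers [q^(1/2) rho_i]. *)
Lemma Tr_zerosE d r (f : {poly F}) : (0 < d)%N -> size f = d.+1 -> f`_0 = 0 ->
    (d%:R : F) != 0 ->
  Tr_zeros n iota psi d r.+1 f =
    - expsum n iota psi f r.+1 / sqrtC (qC p n) ^+ r.+1.
Proof.
move=> d0 fs f0 dF; set c := Lcoef n iota psi f.
have fs' : (size f <= d.+1)%N by rewrite fs.
have c0 m : (d <= m)%N -> c m = 0.
  move=> dm; rewrite /c (Lcoef_chisum _ fs' f0).
  rewrite (chisum_eq0 tracechar0 tracecharD tracechar_neq1) ?d0 //.
  by rewrite prednK // -[d]/(d.+1.-1) -fs -/(lead_coef f) lead_coef_eq0 -size_poly_gt0 fs.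
have c1 : c 0%N = 1 by [].
have LQ : Lpoly n iota psi d f = revp d.-1 (Lrev n iota psi d f).
  apply/polyP=> i; rewrite coef_revp coef_poly coef_poly.
  have -> : (i <= d.-1)%N = (i < d)%N by lia.
  case: ifP => // id; rewrite subKn; last by lia.
  by rewrite (_ : (d.-1 - i < d)%N) //; lia.
have LQ0 : (Lpoly n iota psi d f)`_0 = 1 by rewrite coef_poly d0.
have psL : ps (Lpoly n iota psi d f) r.+1 = - expsum n iota psi f r.+1.
  rewrite (@ps_neglogder _ _ (\poly_(k < r.+1) - expsum n iota psi f k.+1) r.+1) //.
    by rewrite coef_poly ltnSn.
  move=> m mr; rewrite coefD coef_deriv coefM coef_poly.
  have -> : (if (m.+1 < d)%N then Lcoef n iota psi f m.+1 else 0) = c m.+1.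
    by case: ltnP => // /c0.
  rewrite -mulr_natl /c Lcoef_rec mulVKf ?pnatr_eq0 // -big_split big1 // => k _ /=.
  rewrite !coef_poly (_ : (k < r.+1)%N); last by apply: leq_trans mr.
  by case: ltnP => [_|/c0]; rewrite -/c ?mulNr ?subrr // => ->; rewrite !mulr0 subrr.
rewrite /Tr_zeros /Lrecroots; case: closed_field_poly_normal => s /= sE.
(* [Lrev] is monic of degree [d - 1] because the constant coefficient of L is 1. *)
have sL : size (Lrev n iota psi d f) = d.
  apply/eqP; rewrite size_poly_eq // subnn -/(c 0%N) c1; exact: oner_neq0.
have lcL : lead_coef (Lrev n iota psi d f) = 1.
  by rewrite lead_coefE sL coef_poly (_ : (d.-1 < d)%N) ?subnn //; lia.
rewrite lcL scale1r in sE.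
have ss : size s = d.-1 by move: sL; rewrite sE size_prod_XsubC => <-.
have : ps (Lpoly n iota psi d f) r.+1 = \sum_(b <- s) b ^+ r.+1.
  by rewrite LQ sE -ss revp_prod_XsubC ps_prod.
rewrite psL => ->; rewrite mulr_suml.
by apply: eq_bigr => b _; rewrite expr_div_n.
Qed.

End TraceCharacter.

(** * Simultaneous vanishing of traces *)

Section VanishingTraces.
Variables (p n r : nat) (F K : finFieldType) (iota : {rmorphism F -> K}).
Hypotheses (p_pr : prime p) (cardF : #|F| = (p ^ n)%N) (r_gt0 : (0 < r)%N).
Local Notation q := #|F|.
Hypothesis cardK : #|K| = (q ^ r)%N.

(* The trace from K to F of a ^ i, for i > 0. *)
Definition tracepow (a : K) i : F := ps (revp r (charF iota r a)) i.

Lemma frobr (a : K) : a ^+ (q ^ r) = a.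
Proof. by rewrite -cardK expf_card. Qed.

Lemma tracepowE a i : (0 < i)%N ->
  iota (tracepow a i) = \sum_(j < r) a ^+ (q ^ j) ^+ i.
Proof. by case: i => // i _; rewrite (ps_charF p_pr cardF) // frobr. Qed.

Lemma natf_eq0 (L : finFieldType) (f : {rmorphism F -> L}) m :
  ((m%:R : L) == 0) = (p %| m)%N.
Proof. by rewrite -(dvdn_pcharf (pchar_ext p_pr cardF f)). Qed.

Definition traces_vanish D (a : K) : bool :=
  [forall i : 'I_D, ~~ (p %| i)%N ==> (tracepow a i == 0)].

(** The trace of [a^(p l)] is the [p]-th power of the trace of [a^l], so exponents divisible by [p]
    follow by induction. *)
Lemma traces_vanishP D a i : traces_vanish D a -> (0 < i < D)%N -> tracepow a i = 0.
Proof.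
move=> Z; have [N] := ubnP i; elim: N i => // N IH i iN /andP[i0 iD].
have [/dvdnP[l il]|npi] := boolP (p %| i)%N; last first.
  by move/forallP: Z => /(_ (Ordinal iD)); rewrite npi => /eqP.
have p1 := prime_gt1 p_pr.
have l0 : (0 < l)%N by rewrite lt0n; apply: contraTneq i0 => l0; rewrite il l0.
have li : (l < i)%N by rewrite il ltn_Pmulr.
apply: (fmorph_inj iota); rewrite rmorph0 tracepowE //.
have [f fE] := frob_rmorphism p_pr cardF iota 1.
rewrite (eq_bigr (fun j : 'I_r => f (a ^+ (q ^ j) ^+ l))) => [|j _]; last first.
  by rewrite fE expn1 -[RHS]exprM -il.
by rewrite -rmorph_sum -tracepowE // IH ?rmorph0 //; lia.
Qed.

Definition subfixed (a : K) : bool := (p %| r)%N && (a ^+ (q ^ (r %/ p)) == a).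

(** The list of [r] conjugates repeats its first [r/p] entries [p] times, so each power sum is a
    multiple of [p]. *)
Lemma tracepow_subfixed a i : subfixed a -> (0 < i)%N -> tracepow a i = 0.
Proof.
move=> /andP[pr /eqP ar] i0; apply: (fmorph_inj iota).
rewrite rmorph0 tracepowE // -[in LHS](divnK pr) sum_conj //.
by rewrite -mulr_natr; apply/eqP; rewrite mulf_eq0 (natf_eq0 iota) dvdnn orbT.
Qed.

Lemma card_subfixed : #|[pred a | subfixed a]| = ((p %| r) * q ^ (r %/ p))%N.
Proof.
have [pr|npr] := boolP (p %| r)%N; last first.
  by apply: eq_card0 => a; rewrite inE /subfixed (negbTE npr).
have r0 : (0 < r %/ p)%N by rewrite divn_gt0 ?prime_gt0 // dvdn_leq.
have cK : #|K| = (q ^ (r %/ p * p))%N by rewrite divnK.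
rewrite mul1n -(card_fixed iota cK r0).
by apply: eq_card => a; rewrite !inE /subfixed pr.
Qed.

(* If the orbit a_0, ..., a_(e-1) of a under Frobenius has r/e prime to p, all
   sums over the orbit of polynomials of degree < d without constant term
   vanish; X (X - a_1) ... (X - a_(e-1)) shows that a = 0. *)
Lemma traces_vanish_small d a : (r < d)%N -> traces_vanish d a ->
  subfixed a || (a == 0).
Proof.
move=> rd Z; have [e [e0 er ae ue]] := conj_orbit p_pr cardF iota r_gt0 (frobr a).
pose m := (r %/ e)%N; have rE : r = (e * m)%N by rewrite mulnC divnK.
(* If [p] divides [r/e], then [e] divides [r/p] and [a] lies in the subfield. *)
have [pm|npm] := boolP (p %| m)%N.
  rewrite /subfixed rE (dvdn_mull _ pm) -(divnK pm) mulnA mulnK ?prime_gt0 //.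
  by rewrite conj_period ?eqxx.
apply/orP; right; apply/negPn/negP => a0.
have sum0 i : (0 < i < d)%N -> \sum_(j < e) a ^+ (q ^ j) ^+ i = 0.
  move=> id; have /(congr1 iota) := traces_vanishP Z id.
  case/andP: id => i0 _; rewrite rmorph0 tracepowE // rE sum_conj //.
  by move/eqP; rewrite -mulr_natr mulf_eq0 (natf_eq0 iota) (negbTE npm) orbF => /eqP.
pose s := behead (mkseq (fun j => a ^+ (q ^ j)) e).
have sE : mkseq (fun j => a ^+ (q ^ j)) e = a :: s.
  by rewrite /s; case: (e) e0 => // e' _; rewrite /= expr1.
have ss : size s = e.-1 by rewrite size_behead size_mkseq.
pose P := 'X * \prod_(b <- s) ('X - b%:P).
have er' : (e <= r)%N by apply: dvdn_leq.
(* The degree of [P] is [e <= r < d], so only powers with vanishing orbit sums occur. *)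
have sP : (size P <= d)%N.
  rewrite /P mulrC size_mulX ?size_prod_XsubC ?ss; first by lia.
  by rewrite -size_poly_gt0 size_prod_XsubC.
have hP x : P.[x] = \sum_(i < d) P`_i * x ^+ i by rewrite (horner_coef_wide _ sP).
have : \sum_(j < e) P.[a ^+ (q ^ j)] = 0.
  under eq_bigr => j _ do rewrite hP.
  rewrite exchange_big big1 // => i _ /=; rewrite -mulr_sumr.
  have [i0|i0] := posnP i; first by rewrite i0 /P coefXM mul0r.
  by rewrite sum0 ?i0 ?ltn_ord // mulr0.
have -> : \sum_(j < e) P.[a ^+ (q ^ j)] = \sum_(b <- a :: s) P.[b].
  by rewrite -sE big_map -[in RHS](subn0 e) big_mkord.
have Pev x : P.[x] = x * \prod_(b <- s) (x - b).
  rewrite hornerM hornerX horner_prod; congr (_ * _).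
  by apply: eq_bigr => b _; rewrite hornerXsubC.
rewrite big_cons [X in _ + X]big_seq big1 ?addr0 => [|b bs]; last first.
  by rewrite Pev (big_rem b) //= subrr mul0r mulr0.
rewrite Pev => /eqP; rewrite mulf_eq0 (negbTE a0) /= prodf_seq_eq0 => /hasP[b bs].
rewrite subr_eq0 => /eqP ab; move: ue; rewrite sE /= ab => /andP[/negP[]].
by rewrite bs.
Qed.

Lemma prod_dvdn_pow N : (\prod_(i < N) (if p %| i.+1 then q else 1) = q ^ (N %/ p))%N.
Proof.
elim: N => [|N IH]; first by rewrite big_ord0 div0n.
rewrite big_ord_recr /= IH divnS ?prime_gt0 // expnD mulnC.
by case: (p %| N.+1)%N; rewrite ?expn1.
Qed.

Definition lowcoefs (a : K) : {ffun 'I_r -> F} := [ffun i : 'I_r => (charF iota r a)`_i].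

(** The coefficient of [X^i] has index [r - i] in the reversed polynomial; it is forced to be 0 when
    this index is at most [N] and prime to [p], and is free otherwise. *)
Definition allowed N (i : 'I_r) : pred F :=
  if ~~ (p %| r - i)%N && (r - i <= N)%N then pred1 0 else predT.

Lemma lowcoefs_allowed N a : traces_vanish N.+1 a ->
  lowcoefs a \in family (allowed N).
Proof.
move=> Z; apply/familyP => i; rewrite ffunE /allowed.
case: ifP => // /andP[npi iN]; rewrite inE.
have ir : (r - (r - i) = i)%N by have := ltn_ord i; lia.
have Q0 : (revp r (charF iota r a))`_0 = 1.
  by rewrite revp_lead ?(monic_charF p_pr cardF) ?(size_charF p_pr cardF) ?frobr.
have H := ps0_coef Q0 (fun l lN => traces_vanishP Z lN) (i := (r - i)%N).
rewrite coef_revp leq_subr ir subn_gt0 ltn_ord ltnS iN in H.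
move/eqP: (H isT); rewrite -mulr_natr mulf_eq0 (natf_eq0 idfun) (negbTE npi) orbF.
by [].
Qed.

(** The lower coefficients determine the monic characteristic polynomial, and [a] is one of its at
    most [r] roots. *)
Lemma card_lowcoefs_fiber (v : {ffun 'I_r -> F}) :
  (#|[pred a | lowcoefs a == v]| <= r)%N.
Proof.
have [a0 /eqP a0v|] := pickP (fun a => lowcoefs a == v); last first.
  by move=> no; rewrite eq_card0 // => a; rewrite inE no.
set g := map_poly iota (charF iota r a0).
have sg : size g = r.+1 by rewrite size_map_poly (size_charF p_pr cardF) ?frobr.
have g0 : g != 0 by rewrite -size_poly_gt0 sg.
have := max_poly_roots g0 (rs := enum [pred a | lowcoefs a == v]).
rewrite enum_uniq sg ltnS -cardE; apply=> //; apply/allP => a.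
rewrite mem_enum inE -a0v => /eqP lc.
have -> : g = map_poly iota (charF iota r a).
  congr map_poly; apply/polyP => i.
  have [ir|] := ltnP i r; first by have /ffunP/(_ (Ordinal ir)) := lc; rewrite !ffunE.
  have lead b : (charF iota r b)`_r = 1.
    have /monicP := monic_charF p_pr cardF iota (frobr b).
    by rewrite /lead_coef (size_charF p_pr cardF) ?frobr.
  rewrite leq_eqVlt => /orP[/eqP<-|ri]; first by rewrite !lead.
  by rewrite !nth_default ?(size_charF p_pr cardF) ?frobr.
rewrite (map_charF p_pr cardF) ?frobr // (conj_prodE) root_prod_XsubC.
by apply/mapP; exists 0%N; rewrite ?mem_iota ?expr1.
Qed.

(** The free coefficients are the [r - N] of reversed index above [N] and the [N %/ p] whose
    reversed index is a multiple of [p] up to [N]. *)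
Lemma card_allowed N : (N <= r)%N ->
  #|family (allowed N)| = (q ^ (r - N + N %/ p))%N.
Proof.
move=> Nr; have -> : #|family (allowed N)| = (\prod_(i < r) \sum_(x | allowed N i x) 1)%N.
  by rewrite bigA_distr_big_dep -sum1_card; apply: eq_bigr => f _; rewrite big1.
rewrite (eq_bigr (fun i : 'I_r =>
    if ~~ (p %| r - i)%N && (r - i <= N)%N then 1%N else q)) => [|i _]; last first.
  by rewrite sum1_card /allowed; case: ifP => _; rewrite ?card1.
rewrite (reindex_inj rev_ord_inj) /=.
rewrite (eq_bigr (fun i : 'I_r =>
    if ~~ (p %| i.+1)%N && (i.+1 <= N)%N then 1%N else q)) => [|i _]; last first.
  by rewrite subKn.
rewrite -(big_mkord xpredT (fun i => if ~~ (p %| i.+1)%N && (i.+1 <= N)%N then 1%N else q)).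
rewrite (big_cat_nat (n := N)) //= big_mkord expnD mulnC -prod_dvdn_pow; congr (_ * _)%N.
  rewrite big_nat_cond (eq_bigr (fun=> q)) => [|i /andP[/andP[Ni _] _]].
    by rewrite -big_nat_cond prod_nat_const_nat.
  by rewrite ltnNge Ni andbF.
by apply: eq_bigr => i _; rewrite ltn_ord andbT; case: (p %| i.+1)%N.
Qed.

Lemma card_traces_vanish N : (N <= r)%N ->
  (#|[pred a | traces_vanish N.+1 a]| <= r * q ^ (r - N + N %/ p))%N.
Proof.
move=> Nr; rewrite -sum1_card (partition_big lowcoefs (mem (family (allowed N)))) /=; last first.
  by move=> a; apply: lowcoefs_allowed.
apply: (@leq_trans (\sum_(v in family (allowed N)) r)); last first.
  by rewrite sum_nat_const card_allowed // mulnC.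
apply: leq_sum => v _; apply: leq_trans (card_lowcoefs_fiber v).
rewrite -sum1_card [leqRHS](bigID (traces_vanish N.+1)) /=.
by apply: leq_trans (leq_addr _ _); rewrite (eq_bigl _ _ (fun a => andbC _ _)).
Qed.

End VanishingTraces.

(** * The average over the family *)

Section Average.
Variables (p n d r : nat) (F K : finFieldType) (iota : {rmorphism F -> K}).
Hypotheses (p_pr : prime p) (cardF : #|F| = (p ^ n)%N) (r_gt0 : (0 < r)%N).
Local Notation q := #|F|.
Hypotheses (cardK : #|K| = (q ^ r)%N) (p_ndvd_d : ~~ (p %| d)%N).
Variable Theta : F -> algC.
Hypothesis Theta0 : Theta 0 = 1.
Hypothesis ThetaD : {morph Theta : x y / x + y >-> x * y}.
Hypothesis Theta_neq1 : exists x, Theta x != 1.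

Definition fam_coef (i : 'I_d.+1) : pred F :=
  if (p %| i)%N then pred1 0 else if i == ord_max then predC1 0 else predT.

Lemma mem_Fam (a : {ffun 'I_d.+1 -> F}) :
  (a \in Fam p F d) = (a \in family fam_coef).
Proof.
rewrite inE; apply/andP/familyP => [[am /forallP a0] i|fam].
  rewrite /fam_coef; have := a0 i; case: ifP => [_ /=|_ _]; first by rewrite inE.
  by case: eqP => // ->; rewrite inE.
split; first by have := fam ord_max; rewrite /fam_coef /= (negbTE p_ndvd_d) eqxx inE.
by apply/forallP => i; apply/implyP => pi; have := fam i; rewrite /fam_coef pi inE.
Qed.

(** The mean of [Theta (x * t)] over the values [x] permitted for coefficient [i]. The leading
    coefficient avoids 0, whence [-1/(q-1)]. *)
Definition coef_mean (i : 'I_d.+1) (t : F) : algC :=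
  if (p %| i)%N then 1 else
  if i == ord_max then (if t == 0 then 1 else - (q.-1%:R)^-1) else (t == 0)%:R.

Lemma q_gt1 : (1 < q)%N. Proof. exact: card_finNzRing_gt1. Qed.

Lemma sum_fam_coef i t : \sum_(x | fam_coef i x) Theta (x * t) =
  #|fam_coef i|%:R * coef_mean i t.
Proof.
have sumT := sum_Theta Theta0 ThetaD Theta_neq1.
rewrite /fam_coef /coef_mean; case: ifP => _.
  by rewrite card1 mul1r big_pred1_eq mul0r.
case: ifP => _; last first.
  rewrite cardT -cardE; under eq_bigr => x _ do rewrite mulrC.
  by rewrite sumT mulrC.
have q1 := q_gt1; have cC : #|predC1 (0 : F)| = q.-1 by rewrite cardC1.
have := sumT t; rewrite (bigD1 0) //= mulr0 Theta0.
move/(canRL (addKr _)) => e.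
under eq_bigr => x _ do rewrite mulrC.
rewrite e cC; case: eqP => _; rewrite ?mul1r ?mul0r ?addr0 ?mulr1.
  by rewrite -{1}(prednK (ltnW q1)) mulrS addKr.
by rewrite mulrN mulfV // pnatr_eq0 -lt0n -subn1 subn_gt0.
Qed.

Lemma mean_over_Fam (t : 'I_d.+1 -> F) :
  (\sum_(a in Fam p F d) \prod_i Theta (a i * t i)) / #|Fam p F d|%:R =
  \prod_i coef_mean i (t i).
Proof.
have -> : \sum_(a in Fam p F d) \prod_i Theta (a i * t i) =
    (\prod_i #|fam_coef i|%:R) * \prod_i coef_mean i (t i).
  rewrite -big_split /= -(eq_bigr _ (fun i _ => sum_fam_coef i (t i))).
  by rewrite bigA_distr_big_dep; apply: eq_bigl => a; rewrite mem_Fam.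
have -> : #|Fam p F d|%:R = \prod_i #|fam_coef i|%:R :> algC.
  transitivity (\prod_(i < d.+1) \sum_(x | fam_coef i x) (1 : algC)).
    rewrite bigA_distr_big_dep -sumr_const (eq_bigl _ _ mem_Fam).
    by apply: eq_bigr => f _; rewrite big1.
  by apply: eq_bigr => i _; rewrite sumr_const.
rewrite mulrC mulKf //; apply/prodf_neq0 => i _; rewrite pnatr_eq0 /fam_coef.
have q1 := q_gt1; case: ifP => _; first by rewrite card1.
case: ifP => _; first by rewrite cardC1 -lt0n -subn1 subn_gt0.
by rewrite -lt0n; apply: ltnW.
Qed.

Local Notation tp := (@tracepow r F K iota).
Local Notation tv := (@traces_vanish p r F K iota).

(** The average over the family of the character value of the trace of [f(a)], by
    [mean_over_Fam]. *)
Definition weight (a : K) : algC := \prod_(i < d.+1) coef_mean i (tp a i).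

Lemma weightE a : weight a =
  (tv d a)%:R * (if tp a d == 0 then 1 else - (q.-1%:R)^-1).
Proof.
rewrite /weight big_ord_recr /= {2}/coef_mean /= (negbTE p_ndvd_d) eqxx.
congr (_ * _); rewrite /traces_vanish; case: forallP => [Z|Z].
  rewrite big1 // => i _; rewrite /coef_mean /=; have := Z i.
  case: ifP => //= _ /eqP->; rewrite eqxx.
  by rewrite (ltn_eqF (ltn_ord i) : (widen_ord (leqnSn d) i == ord_max) = false).
apply/eqP; rewrite prodf_seq_eq0; apply/hasP.
have /existsP[i] : [exists i : 'I_d, ~~ (~~ (p %| i)%N ==> (tp a i == 0))].
  by rewrite -negb_forall; apply/negP => /forallP.
rewrite negb_imply => /andP[npi ti]; exists i; rewrite ?mem_index_enum //=.
rewrite /coef_mean /= (negbTE npi) (negbTE ti).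
by rewrite (ltn_eqF (ltn_ord i) : (widen_ord (leqnSn d) i == ord_max) = false).
Qed.

Lemma traces_vanishS a : tv d.+1 a = tv d a && (tp a d == 0).
Proof.
apply/forallP/andP => [Z|[/forallP Z td] i].
  split; last by have := Z ord_max; rewrite /= p_ndvd_d.
  by apply/forallP => i; have := Z (widen_ord (leqnSn d) i).
have := ltn_ord i; rewrite ltnS leq_eqVlt => /orP[/eqP ->|id].
  by apply/implyP.
exact: Z (Ordinal id).
Qed.

Definition Efix := [pred a : K | subfixed p r F a].

Lemma weight_subfixed a : a \in Efix -> weight a = 1.
Proof.
rewrite inE => Ea; have d0 : (0 < d)%N by case: d p_ndvd_d; rewrite ?dvdn0.
have t0 i : (0 < i)%N -> tp a i = 0.
  exact: (tracepow_subfixed iota p_pr cardF cardK Ea).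
rewrite weightE t0 // eqxx mulr1 (_ : tv d a = true) //.
apply/forallP => i; apply/implyP => npi; rewrite t0 // lt0n.
by apply: contraNneq npi => ->; rewrite dvdn0.
Qed.

Lemma pred_q_inv_le1 : (q.-1%:R : algC)^-1 <= 1.
Proof.
have q1 := q_gt1; rewrite invf_le1 ?ler1n ?ltr0n; lia.
Qed.

Lemma weight_bound a : `|weight a| <=
  (tv d.+1 a)%:R + (tv d a)%:R * (q.-1%:R)^-1.
Proof.
have i0 : 0 <= (q.-1%:R : algC)^-1 by rewrite invr_ge0 ler0n.
rewrite weightE traces_vanishS; case: (tv d a) => /=.
  case: eqP => _; rewrite !mul1r ?normr1 ?normrN ?(ger0_norm i0) ?add0r //.
  by rewrite lerDl.
by rewrite !mul0r normr0 addr0.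
Qed.

Lemma weight_le1 a : `|weight a| <= 1.
Proof.
have i0 : 0 <= (q.-1%:R : algC)^-1 by rewrite invr_ge0 ler0n.
rewrite weightE normrM; case: (tv d a); rewrite ?normr0 ?mul0r // normr1 mul1r.
by case: eqP => _; rewrite ?normr1 // normrN ger0_norm // pred_q_inv_le1.
Qed.

(** Elements of the subfield have weight 1, and their number is the main term. *)
Lemma sum_weight_error :
  `| \sum_a weight a - ((p %| r) * q ^ (r %/ p))%N%:R | <=
     \sum_(a | a \notin Efix) `|weight a|.
Proof.
rewrite -(card_subfixed iota p_pr r_gt0 cardK) (bigID (mem Efix)) /=.
rewrite (eq_bigr (fun=> 1)) => [|a /weight_subfixed //].
rewrite sumr_const addrC addrK; exact: ler_norm_sum.
Qed.

Lemma sum_weight_bound :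
  `| \sum_a weight a - ((p %| r) * q ^ (r %/ p))%N%:R | <=
  3%:R * (r%:R * (q%:R ^+ r * q%:R ^+ (d %/ p) / q%:R ^+ d)) + 1.
Proof.
have q1 := q_gt1; have q0 : 0 < (q%:R : algC) by rewrite ltr0n; lia.
have qn0 : (q%:R : algC) != 0 by rewrite gt_eqF.
have d0 : (0 < d)%N by case: d p_ndvd_d; rewrite ?dvdn0.
apply: le_trans sum_weight_error _.
(* For [r < d] only [a = 0] can contribute outside the subfield, which accounts for the summand
   1. *)
have [rd|dr] := ltnP r d.
  apply: (@le_trans _ _ (\sum_(a : K | a == 0) 1)); last first.
    rewrite big_pred1_eq lerDr mulr_ge0 ?mulr_ge0 ?invr_ge0 ?exprn_ge0 ?ler0n //.
  rewrite [leLHS]big_mkcond [leRHS]big_mkcond; apply: ler_sum => a _.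
  case: ifP => // nE; last by case: ifP.
  case: eqP => [_|/eqP a0]; first exact: weight_le1.
  rewrite weightE; case Z: (tv d a); last by rewrite mul0r normr0.
  have := traces_vanish_small p_pr cardF r_gt0 cardK rd Z.
  by rewrite (negbTE a0) orbF; move: nE; rewrite inE => /negbTE->.
apply: (@le_trans _ _ (\sum_a ((tv d.+1 a)%:R + (tv d a)%:R * (q.-1%:R)^-1))).
  rewrite big_mkcond; apply: ler_sum => a _; case: ifP => _; first exact: weight_bound.
  by rewrite addr_ge0 ?mulr_ge0 ?invr_ge0 ?ler0n.
rewrite big_split -mulr_suml /=.
have cnt D : \sum_a (tv D a)%:R = (#|[pred a | tv D a]|)%:R :> algC.
  by rewrite -sum1_card natr_sum [RHS]big_mkcond; apply: eq_bigr => a _; rewrite inE; case: (tv D a).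
rewrite !cnt; set B := r%:R * _.
have B0 : 0 <= B by rewrite /B !mulr_ge0 ?invr_ge0 ?exprn_ge0 ?ler0n.
have BE : (r * q ^ (r - d + d %/ p))%N%:R = B.
  rewrite natrM natrX exprD /B.
  have -> : (q%:R : algC) ^+ r = q%:R ^+ (r - d) * q%:R ^+ d by rewrite -exprD subnK.
  by rewrite [in RHS]mulrAC mulfK ?expf_neq0.
have h1 : (#|[pred a | tv d.+1 a]|%:R : algC) <= B.
  by rewrite -BE ler_nat; apply: (card_traces_vanish iota p_pr cardF r_gt0 cardK).
(* With one condition fewer the exponent of [q] grows by at most 1. The weight [1/(q-1)]
   compensates, as [q/(q-1) <= 2]; together with [h1] this gives the constant 3 = 1 + 2. *)
have h2 : (#|[pred a | tv d a]|%:R : algC) <= B * q%:R.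
  rewrite -BE -natrM ler_nat -{1}(prednK d0).
  have dr' : (d.-1 <= r)%N by lia.
  apply: leq_trans (card_traces_vanish iota p_pr cardF r_gt0 cardK dr') _.
  rewrite -mulnA -expnSr leq_mul2l; apply/orP; right; rewrite leq_exp2l //.
  by have := leq_div2r p (leq_pred d); lia.
have h3 : q%:R * (q.-1%:R)^-1 <= 2%:R :> algC.
  rewrite ler_pdivrMr ?ltr0n -?natrM ?ler_nat; lia.
apply: (@le_trans _ _ (B + B * 2%:R)); last first.
  by rewrite -{1}[B]mulr1 -mulrDr nat1r mulrC lerDl ler01.
apply: lerD => //; apply: le_trans (ler_wpM2l B0 h3); rewrite mulrA.
by rewrite ler_wpM2r // invr_ge0 ler0n.
Qed.

End Average.

Theorem theorem1 :
  exists C : nat,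
  forall (p n d r : nat) (F : finFieldType) (K : nat -> finFieldType)
         (iota : forall s, {rmorphism F -> K s}) (psi : 'F_p -> algC),
    prime p -> (0 < n)%N -> #|F| = (p ^ n)%N ->
    (forall s, (0 < s)%N -> #|K s| = ((p ^ n) ^ s)%N) ->
    coprime d p ->
    psi 0 = 1 -> {morph psi : x y / x + y >-> x * y} -> (exists x, psi x != 1) ->
    (0 < r)%N ->
    let q := qC p n in
    `| @Mavg p n F K iota psi d r
       - (- epr p r * ((p.-root q) ^+ r / sqrtC q ^+ r)) |
    <= C%:R * (r%:R * (sqrtC q ^+ r * (p.-root q) ^+ d / q ^+ d)
               + (sqrtC q ^+ r)^-1).
Proof.
exists 3%N => p n d r F K iota psi p_pr n0 cardF cardK dp psi0 psiD psi1.
case: r => // r _; cbv zeta; set q := qC p n.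
have cK s : (0 < s)%N -> #|K s| = (#|F| ^ s)%N by rewrite cardF; apply: cardK.
have npd : ~~ (p %| d)%N by rewrite -prime_coprime // coprime_sym.
have [j jE] := prime_embedding p_pr cardF.
have Th0 := tracechar0 n p_pr psi0 j.
have ThD := tracecharD p_pr cardF psiD j.
have Th1 := tracechar_neq1 p_pr cardF psi1 j.
set Th := tracechar n psi j in Th0 ThD Th1.
have qE : q = #|F|%:R by rewrite /q /qC cardF.
have q0 : 0 < q by rewrite qE ltr0n (ltnW (q_gt1 F)).
have d0 : (0 < d)%N by case: d npd {dp}; rewrite ?dvdn0.
have dF : (d%:R : F) != 0 by rewrite (natf_eq0 p_pr cardF idfun).
have p0 := prime_gt0 p_pr.
set sq := sqrtC q; have sq0 : 0 < sq by rewrite sqrtC_gt0.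
set rt := p.-root q.
have rt1 : 1 <= rt by rewrite -(rootC1 _ p0) ler_rootC ?nnegrE ?ler01 ?(ltW q0) // qE ler1n ltnW ?q_gt1.
have rtp : rt ^+ p = q by rewrite rootCK.
pose avg a := weight p d r.+1 (iota r.+1) a.
have -> : Mavg n iota psi d r.+1 = - (\sum_a avg a) / sq ^+ r.+1.
  rewrite /Mavg.
  have famE a : a \in Fam p F d -> Tr_zeros n iota psi d r.+1 (polyOf a) =
     (\sum_(x : K r.+1) \prod_i Th (a i * tracepow r.+1 (iota r.+1) x i)) * (- (sq ^+ r.+1)^-1).
    rewrite inE => /andP[am /forallP a0].
    have sz : size (polyOf a) = d.+1.
      by rewrite size_poly_eq // -[d in inord d]/(nat_of_ord (@ord_max d)) inord_val.
    have co (i : 'I_d.+1) : (polyOf a)`_i = a i by rewrite coef_poly ltn_ord inord_val.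
    have az : a ord0 = 0 by have /implyP/(_ (dvdn0 p))/eqP := a0 ord0.
    have pz : (polyOf a)`_0 = 0 by rewrite (co ord0).
    rewrite (Tr_zerosE iota p_pr cardF cK psi0 psiD psi1 jE) // mulNr mulrN; congr (- (_ * _)).
    rewrite (expsum_conjsum iota psi p_pr cardF cK jE (d := d)) ?sz //.
    apply: eq_bigr => x _; rewrite big_ord_recl az mul0r Th0 mul1r.
    rewrite /chi -/Th (Theta_sum Th0 ThD); apply: eq_bigr => i _; congr (Th (_ * _)).
    exact: (co (lift ord0 i)).
  rewrite (eq_bigr _ famE) -mulr_suml exchange_big /=.
  rewrite mulrAC mulr_suml mulrN mulNr; congr (- (_ / _)).
  by apply: eq_bigr => x _; rewrite (mean_over_Fam npd Th0 ThD Th1).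
(* When [p] divides the exponent, the power of the [p]-th root is an integral power of [q]. *)
have -> : - epr p r.+1 * (rt ^+ r.+1 / sq ^+ r.+1) =
    - (((p %| r.+1) * #|F| ^ (r.+1 %/ p))%N%:R / sq ^+ r.+1).
  rewrite mulNr mulrA /epr natrM natrX -qE; congr (- (_ / _)).
  case: (boolP (p %| r.+1)%N) => [pr|]; last by rewrite !mul0r.
  by rewrite -rtp -exprM mulnC divnK.
rewrite mulNr opprK addrC -mulrBl normrM normfV (ger0_norm (exprn_ge0 _ (ltW sq0))) distrC.
have bd := sum_weight_bound (iota r.+1) p_pr cardF (ltn0Sn r) (cK _ (ltn0Sn r)) npd.
have sqX : q ^+ r.+1 = sq ^+ r.+1 * sq ^+ r.+1 by rewrite -exprMn -expr2 sqrtCK.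
have s0 : 0 < sq ^+ r.+1 by rewrite exprn_gt0.
rewrite ler_pdivrMr //; apply: le_trans bd _; rewrite -qE.
rewrite -[leRHS]mulrA [X in _ <= _ * X]mulrDl mulVf ?gt_eqF // [leRHS]mulrDr mulr1.
apply: lerD; last by rewrite ler1n.
rewrite ler_wpM2l ?ler0n // -[leRHS]mulrA ler_wpM2l ?ler0n //.
have -> : sq ^+ r.+1 * rt ^+ d / q ^+ d * sq ^+ r.+1 = q ^+ r.+1 * rt ^+ d / q ^+ d.
  by rewrite sqX; ring.
(* Rounding costs nothing: [q^(d %/ p)] is [rt] to the power [p (d %/ p) <= d], and [rt >= 1]. *)
rewrite ler_wpM2r ?invr_ge0 ?exprn_ge0 ?(ltW q0) // ler_wpM2l ?exprn_ge0 ?(ltW q0) //.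
by rewrite -{1}rtp -exprM ler_weXn2l // mulnC leq_trunc_div.
Qed.
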